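(* Let $\varepsilon_0 \in \{\pm 1\}$ and let $A$ be a set of prime powers with $|A| \ge 3$ such that, whenever $q$ is a prime dividing $\prod_{a \in B} a - \varepsilon_0$ for some $B \in \mathcal P_\star(A)$, $q$ divides some element of $A$. Then $A$ is infinite. Moreover, if $\varepsilon_0 = 1$, then every prime divides some element of $A$. Finally, if $A$ consists of primes only (i.e. $A \subseteq \mathbb P$), then $A = \mathbb P$.
   Context: $\mathbb P$ denotes the set of all positive rational primes. A prime power is a number of the form $p^k$ with $p$ prime and $k \ge 1$ (so $1$ is not a prime power). For a set $X$, $\mathcal P_\star(X)$ denotes the family of all finite nonempty proper subsets of $X$. *)

(* Defs.v *)
From mathcomp Require Import all_boot all_order all_algebra.
From mathcomp Require Import finmap.
From mathcomp Require Import mathcomp_extra boolp classical_sets functions cardinality.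

Set Implicit Arguments.
Unset Strict Implicit.
Unset Printing Implicit Defensive.

Local Open Scope classical_set_scope.

Definition primeset : set nat := [set p | prime p].

Definition prime_power (n : nat) : Prop :=
  exists p k : nat, [/\ prime p, 0 < k & n = p ^ k].

(* Finite subsets are represented by finmap's {fset T}. *)
Definition Pstar (T : choiceType) (X : set T) : set {fset T} :=
  [set B : {fset T} | B != fset0 /\ [set` B] `<` X].

(* Main.v *)
(** Suppose A is finite with product N. The prime factors of
    N / a - eps0 divide elements of A but not N / a, so they divide a only;
    hence A is pairwise coprime and N / a - eps0 is a power of the prime of a.
    Comparing with M = N / (a b), one gets that M - eps0 divides
    (a - 1)(b - 1). For |A| >= 4 this contradicts the size of M when a and b
    are the two smallest elements; for |A| = 3 the three divisibilities,
    together with the fact that one element is even, leave no solution.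

    If A is infinite and a prime p divides no element of A, consider the set H
    ([persistent] below) of residues mod p that are products over finite subsets of A avoiding any
    prescribed finite set. H is closed under multiplication and contains the
    residues of all but finitely many elements of A, so 1 is in H by Fermat;
    this settles eps0 = 1. If A consists of primes and eps0 = -1, then
    x |-> f x + 1, for f the product of a suitable finite subset of A, maps H
    injectively into H, hence onto H, and f x + 1 = 1 for some unit x. *)

Require Import Defs.
From mathcomp Require Import all_boot all_order all_algebra.
From mathcomp Require Import finmap zify finfield.
From mathcomp Require Import mathcomp_extra boolp classical_sets functions cardinality.


Set Implicit Arguments.
Unset Strict Implicit.
Unset Printing Implicit Defensive.

Import GRing.Theory.

Local Open Scope classical_set_scope.

(** * Divisors of [n - eps0] *)

(* [shift e n] is the natural number n - eps0, with e encoding eps0 = 1. *)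
Definition shift (e : bool) (n : nat) : nat := if e then n.-1 else n.+1.

Lemma dvdn_shift_gcd e q n : 0 < n -> q %| n -> q %| shift e n -> q %| 1.
Proof.
case: e; case: n => //= n _ qn; last by rewrite -addn1 dvdn_addr.
by move=> qn'; move: qn; rewrite -addn1 dvdn_addr.
Qed.

(** Modulo [d], both [x] and [x * y] equal the unit eps0, so [y] is 1. *)
Lemma dvdn_shift_mul e d x y : 0 < x -> 0 < y ->
  d %| shift e x -> d %| shift e (x * y) -> d %| y.-1.
Proof.
move=> x0 y0 dx dxy; case: e dx dxy => /= dx dxy.
  have -> : y.-1 = (x * y).-1 - x.-1 * y by nia.
  by rewrite dvdn_sub // dvdn_mulr.
have -> : y.-1 = x.+1 * y - (x * y).+1 by nia.
by rewrite dvdn_sub // dvdn_mulr.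
Qed.

Lemma leq_shift e m n : m <= n -> shift e m <= shift e n.
Proof. by case: e => /=; lia. Qed.

Lemma shift_gt0 e n : 1 < n -> 0 < shift e n.
Proof. by case: e => /=; lia. Qed.

Lemma shift_gt1 e n : 2 < n -> 1 < shift e n.
Proof. by case: e => /=; lia. Qed.

Lemma pnat_dvd_leq (p m n : nat) : prime p ->
  p.-nat m -> p.-nat n -> m <= n -> m %| n.
Proof.
move=> pp /p_natP[i ->] /p_natP[j ->].
by rewrite leq_exp2l ?prime_gt1 //; exact: dvdn_exp2l.
Qed.

Lemma pnat_eq1 (p n : nat) : prime p -> p.-nat n -> ~~ (p %| n) -> n = 1.
Proof.
move=> pp /p_natP[[|k] ->] //.
by rewrite expnS dvdn_mulr.
Qed.

Lemma pnat_neq_coprime (p q m n : nat) : prime p -> prime q -> p != q ->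
  p.-nat m -> q.-nat n -> coprime m n.
Proof.
move=> pp pq pneq /p_natP[i ->] /p_natP[j ->].
by rewrite coprimeXl // coprimeXr // prime_coprime // dvdn_prime2.
Qed.

Lemma prime_power_gt1 a : prime_power a -> 1 < a.
Proof.
move=> [p [k [pp k0 ->]]]; case: k k0 => // k _; rewrite expnS.
have := prime_gt1 pp; have : 0 < p ^ k by rewrite expn_gt0 prime_gt0.
nia.
Qed.

Lemma pdiv_prime_power a : prime_power a -> prime (pdiv a).
Proof. by move/prime_power_gt1/pdiv_prime. Qed.

Lemma prime_power_pnat a : prime_power a -> (pdiv a).-nat a.
Proof.
move=> [p [k [pp k0 ->]]]; case: k k0 => // k _.
by rewrite pdiv_pfactor // pnatX pnat_id.
Qed.

Lemma prime_power_pdivE a q : prime_power a -> prime q -> q %| a ->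
  q = pdiv a.
Proof.
move=> aP pq qa; have /pnatP := prime_power_pnat aP.
by move/(_ (ltnW (prime_power_gt1 aP)) _ pq qa)/eqP.
Qed.

Lemma prod_gt0 (s : seq nat) : {in s, forall x, prime_power x} ->
  0 < \prod_(x <- s) x.
Proof.
move=> sP; rewrite big_seq; apply: prodn_cond_gt0 => x xs.
exact: ltnW (prime_power_gt1 (sP _ xs)).
Qed.

Lemma prod_gt1 (s : seq nat) : {in s, forall x, prime_power x} ->
  s != [::] -> 1 < \prod_(x <- s) x.
Proof.
case: s => // a s sP _; rewrite big_cons.
have := prime_power_gt1 (sP a (mem_head _ _)).
have /prod_gt0 : {in s, forall x, prime_power x}.
  by move=> x xs; apply: sP; rewrite inE xs orbT.
nia.
Qed.

Lemma dvdn_prod_mem (s : seq nat) x : x \in s -> x %| \prod_(y <- s) y.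
Proof. by move=> xs; rewrite (big_rem x) //= dvdn_mulr. Qed.

Lemma prime_ndvd_prod p (s : seq nat) : prime p ->
  {in s, forall x, ~~ (p %| x)} -> ~~ (p %| \prod_(x <- s) x).
Proof.
move=> pp sP; rewrite big_seq; elim/big_ind: _ => [|x y|x /sP //].
  by rewrite dvdn1 eq_sym ltn_eqF // prime_gt1.
by rewrite Euclid_dvdM // negb_or => -> ->.
Qed.

(** * Finite sets: prime factors of subproducts minus eps0 *)

(** The divisibility hypothesis for a finite [A] listed by [s]; properness of the subset [t] is
    expressed by its size. *)
Definition shift_closed e (s : seq nat) : Prop :=
  [/\ uniq s, {in s, forall x, prime_power x} &
   forall q t, prime q -> uniq t -> {subset t <= s} -> t != [::] ->
     size t < size s -> q %| shift e (\prod_(x <- t) x) ->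
     exists2 a, a \in s & q %| a].

Lemma shift_closed_perm e s t : perm_eq s t -> shift_closed e s ->
  shift_closed e t.
Proof.
move=> st [us sP sD]; have stE := perm_mem st; split.
- by rewrite -(perm_uniq st).
- by move=> x; rewrite -stE; apply: sP.
- move=> q u pq uu ut u0; rewrite -(perm_size st) => ls qd.
  have [|a as_ qa] := sD q u pq uu _ u0 ls qd.
    by move=> x /ut; rewrite stE.
  by exists a; rewrite -?stE.
Qed.

(** A prime dividing an element of [t] divides the product of [t], hence cannot also divide that
    product minus eps0; only the elements of the complement [r] remain. *)
Lemma shift_closed_dvd e s r t q : perm_eq s (r ++ t) -> shift_closed e s ->
  r != [::] -> t != [::] -> prime q -> q %| shift e (\prod_(x <- t) x) ->
  exists2 a, a \in r & q = pdiv a.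
Proof.
move=> st sC r0 t0 pq qd.
have [uc cP cD] := shift_closed_perm st sC.
have tP : {in t, forall x, prime_power x}.
  by move=> x xt; apply: cP; rewrite mem_cat xt orbT.
have [|||a] := cD q t pq _ _ t0 _ qd.
- by move: uc; rewrite cat_uniq => /and3P[].
- by move=> x xt; rewrite mem_cat xt orbT.
- by rewrite size_cat; case: (r) r0 => //= *; rewrite addSn ltnS leq_addl.
rewrite mem_cat => /orP[ar|at_] qa.
  exists a => //; apply: prime_power_pdivE => //.
  by apply: cP; rewrite mem_cat ar.
have qt := dvdn_trans qa (dvdn_prod_mem at_).
have := dvdn_shift_gcd (prod_gt0 tP) qt qd.
by rewrite dvdn1 => /eqP q1; rewrite q1 in pq.
Qed.

(** This is the case of complement [[:: a]]. If some [b] in [t] had the same prime as [a], that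
    prime would divide both the product of [t] and its shift. *)
Lemma shift_closed_co1 e a t : 1 < size t -> shift_closed e (a :: t) ->
  (pdiv a).-nat (shift e (\prod_(x <- t) x)) /\
  {in t, forall b, pdiv a != pdiv b}.
Proof.
move=> st sC; have [us sP _] := sC.
have t0 : t != [::] by case: (t) st.
have tP : {in t, forall x, prime_power x}.
  by move=> x xt; apply: sP; rewrite inE xt orbT.
have qE q : prime q -> q %| shift e (\prod_(x <- t) x) -> q = pdiv a.
  move=> pq qd.
  have [||b] := @shift_closed_dvd e (a :: t) [:: a] t q _ sC _ t0 pq qd => //.
  by rewrite inE => /eqP ->.
(* Exceeding 2 ensures that the shift has a prime divisor even when eps0 = 1. *)
have t2 : 2 < \prod_(x <- t) x.
  case: (t) st tP => [|b [|c u]] // _ tP; rewrite big_cons.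
  have := prime_power_gt1 (tP b (mem_head _ _)).
  have : 1 < \prod_(x <- c :: u) x.
    by apply: prod_gt1 => // x xu; apply: tP; rewrite inE xu orbT.
  nia.
have s0 : 1 < shift e (\prod_(x <- t) x) by apply: shift_gt1.
split.
  apply/pnatP => [|q pq qd]; first exact: ltnW.
  by rewrite (qE q pq qd) inE.
move=> b bt; apply/eqP => ab.
have pq := pdiv_prime s0; have qd := pdiv_dvd (shift e (\prod_(x <- t) x)).
have qa := qE _ pq qd.
have qt : pdiv (shift e (\prod_(x <- t) x)) %| \prod_(x <- t) x.
  by rewrite {1}qa ab (dvdn_trans (pdiv_dvd b)) // dvdn_prod_mem.
have := dvdn_shift_gcd (ltnW (ltnW t2)) qt qd.
by rewrite dvdn1 => /eqP q1; rewrite q1 in pq.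
Qed.

(* With p = pdiv a and M the product of t, both p^x = (M - eps0)_p and
   b M - eps0 are powers of p, so p^x divides b M - eps0 and hence b - 1. *)
Lemma shift_closed_co2 e a b t : t != [::] -> shift_closed e [:: a, b & t] ->
  exists u v, [/\ shift e (\prod_(x <- t) x) = u * v, (pdiv a).-nat u,
     (pdiv b).-nat v, u %| b.-1 & v %| a.-1].
Proof.
move=> t0 sC; have [us sP _] := sC.
have sC' : shift_closed e [:: b, a & t].
  by apply: shift_closed_perm sC; rewrite (perm_catCA [:: a] [:: b] t).
have st : 0 < size t by case: (t) t0.
have [an anb] := @shift_closed_co1 e a (b :: t) st sC.
have [bn bna] := @shift_closed_co1 e b (a :: t) st sC'.
have ab := anb b (mem_head _ _).
have tP : {in t, forall x, prime_power x}.
  by move=> x xt; apply: sP; rewrite !inE xt !orbT.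
have aP : prime_power a by apply: sP; rewrite inE eqxx.
have bP : prime_power b by apply: sP; rewrite !inE eqxx orbT.
have [a1 b1] := (prime_power_gt1 aP, prime_power_gt1 bP).
have [pa pb] := (pdiv_prime_power aP, pdiv_prime_power bP).
move: an bn; rewrite !big_cons; set M := \prod_(x <- t) x => an bn.
have M1 : 1 < M by apply: prod_gt1.
have s0 : 0 < shift e M by apply: shift_gt0.
have part_dvd c d : prime (pdiv c) -> 1 < d ->
    (pdiv c).-nat (shift e (d * M)) -> (shift e M)`_(pdiv c) %| d.-1.
  move=> pc d1 cn; apply: (@dvdn_shift_mul e _ M); try exact: ltnW.
    exact: dvdn_part.
  rewrite mulnC; apply: (pnat_dvd_leq pc) => //; first exact: part_pnat.
  apply: (leq_trans (dvdn_leq s0 (dvdn_part _ _))).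
  by apply/leq_shift/leq_pmull/ltnW.
exists (shift e M)`_(pdiv a), (shift e M)`_(pdiv b).
split; rewrite ?part_pnat //; try exact: part_dvd.
(* Only the primes of [a] and [b] can divide [M - eps0], so its part prime to [pdiv a] is its
   [pdiv b]-part. *)
rewrite -{1}(partnC (pdiv a) s0); congr (_ * _).
apply: eq_in_partn => q; rewrite mem_primes => /and3P[pq _ qd].
have [||c] :=
  @shift_closed_dvd e [:: a, b & t] [:: a; b] t q _ sC _ t0 pq qd => //.
rewrite !inE => /orP[]/eqP -> ->; last by rewrite eqxx eq_sym ab.
by rewrite eqxx (negbTE ab).
Qed.

(* The product of the elements other than the two smallest ones, a and b,
   exceeds a b, whereas it is at most (a - 1)(b - 1) + 1. *)
Lemma shift_closed_ge4 e s : 3 < size s -> ~ shift_closed e s.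
Proof.
move=> s4 sC.
have sC' : shift_closed e (sort leq s).
  by apply: shift_closed_perm sC; rewrite perm_sym perm_sort.
have [us sP _] := sC'.
have : sorted ltn (sort leq s).
  by rewrite ltn_sorted_uniq_leq us sort_sorted //; apply: leq_total.
move: s4; rewrite -(size_sort leq).
case: (sort leq s) sC' sP {us} => [|a [|b [|c [|d t]]]] // sC' sP _.
move=> /= /and4P[ab bc cd _].
have [//|u [v [sE _ _ uB vA]]] := @shift_closed_co2 e a b [:: c, d & t] _ sC'.
have a1 : 1 < a by apply/prime_power_gt1/sP; rewrite inE eqxx.
have t0 : 0 < \prod_(x <- t) x.
  by apply: prod_gt0 => x xt; apply: sP; rewrite !inE xt !orbT.
have := dvdn_leq _ uB; have := dvdn_leq _ vA; move: sE.
rewrite !big_cons; set T := \prod_(x <- t) x in t0 *.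
move=> sE vl ul; have {}vl : v <= a.-1 by apply: vl; lia.
have {}ul : u <= b.-1 by apply: ul; lia.
have uv : u * v <= b.-1 * a.-1 by apply: leq_mul.
have cdT : c * d <= c * (d * T) by nia.
have : c * d <= (u * v).+1 by rewrite -sE; case: (e) => /=; nia.
have : b.+1 * (a.+1) <= c * d by apply: leq_mul; lia.
move: uv; have [-> ->] : a = a.-1.+1 /\ b = b.-1.+1 by lia.
by move: (a.-1) (b.-1) => x y /=; nia.
Qed.

(** * Sets of three elements *)

Lemma shift_closed_rot e a b c : shift_closed e [:: a; b; c] ->
  shift_closed e [:: b; c; a].
Proof. by apply: shift_closed_perm; rewrite (perm_catC [:: a] [:: b; c]). Qed.

Lemma shift_closed_facts e a b c : shift_closed e [:: a; b; c] ->
  [/\ prime_power a, pdiv a != pdiv b, (pdiv a).-nat (shift e (b * c)) &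
   exists u v, [/\ shift e c = u * v, (pdiv a).-nat u, (pdiv b).-nat v,
     u %| b.-1 & v %| a.-1]].
Proof.
move=> sC; have [_ sP _] := sC.
have [an ab] := @shift_closed_co1 e a [:: b; c] isT sC.
have := @shift_closed_co2 e a b [:: c] isT sC.
move: an; rewrite big_cons !big_seq1 => an [u [v H]].
split; rewrite ?ab ?mem_head //; first by apply: sP; rewrite mem_head.
by exists u, v.
Qed.

Lemma prime_power_even a : prime_power a -> ~~ odd a -> pdiv a = 2.
Proof.
by move=> aP; rewrite -dvdn2 => /(@prime_power_pdivE a 2 aP isT).
Qed.

(** If all three were odd, [b * c - eps0] would be even and a power of the prime of [a], forcing
    that prime to be 2. *)
Lemma shift_closed_even e a b c : shift_closed e [:: a; b; c] ->
  exists a' b' c', shift_closed e [:: a'; b'; c'] /\ ~~ odd a'.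
Proof.
move=> sC; have [ao|ae] := boolP (odd a); last by exists a, b, c.
have sC' := shift_closed_rot sC.
have [bo|be] := boolP (odd b); last by exists b, c, a.
have [co|ce] := boolP (odd c).
  have [aP _ an _] := shift_closed_facts sC.
  have [bP _ _ _] := shift_closed_facts sC'.
  have [cP _ _ _] := shift_closed_facts (shift_closed_rot sC').
  have b1 := prime_power_gt1 bP; have c1 := prime_power_gt1 cP.
  have bc2 : 2 %| shift e (b * c).
    rewrite dvdn2; have : odd (b * c) by rewrite oddM bo co.
    have : 0 < b * c by nia.
    by case: (e) => /=; case: (b * c) => //= n _; rewrite ?negbK.
  have /pnatP : (pdiv a).-nat (shift e (b * c)) by [].
  move=> /(_ (shift_gt0 _ _) 2 isT bc2) a2.
  have {a2} : 2 \in (pdiv a : nat_pred) by apply: a2; nia.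
  rewrite inE => /eqP a2.
  by have := pdiv_dvd a; rewrite -a2 dvdn2 ao.
by exists c, a, b; split=> //; apply: shift_closed_rot.
Qed.

(** Serves to identify the factors belonging to the same prime in two of [a - 1], [b - 1],
    [c - 1]. *)
Lemma dvdn_coprime_eq u v u' w : coprime u w -> coprime u' v ->
  u %| u' * w -> u' %| u * v -> u = u'.
Proof.
move=> cw cv; rewrite Gauss_dvdl // => uu'; rewrite Gauss_dvdl // => u'u.
by apply/eqP; rewrite eqn_dvd uu' u'u.
Qed.

(** The product is [(1 + u w)(1 + u v) - 1], that is [b c - 1]. Its two factors are powers of [p],
    so the smaller one, [u], divides the other. *)
Lemma pnat_pair_dvd (p u v w : nat) : prime p -> 0 < w -> 0 < v ->
  p.-nat (u * (u * v * w + v + w)) -> u %| v + w.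
Proof.
move=> pp w0 v0; rewrite pnatM => /andP[un Tn].
have : u %| u * v * w + v + w.
  apply: (pnat_dvd_leq pp) => //; rewrite -addnA; apply: leq_trans (leq_addr _ _).
  by rewrite -mulnA leq_pmulr // muln_gt0 v0.
by rewrite -addnA dvdn_addr // -mulnA dvdn_mulr.
Qed.

Lemma prod_le_sum u v w : 1 < u -> odd v -> odd w -> v < w ->
  u * v * w <= u + v + w -> [/\ u = 2, v = 1 & w = 3].
Proof.
move=> u1 vo wo lt_vw; have w3 : v.+2 <= w.
  by rewrite ltn_neqAle lt_vw andbT; apply/eqP => wE; rewrite -wE /= vo in wo.
case: v vo lt_vw w3 => [|[|[|v]]] //= _ _ w3 S_le.
  have w2 : w = 3 by nia.
  by split=> //; nia.
have : u * (3 * w) <= u * v.+3 * w by rewrite mulnA leq_mul2r leq_mul2l; lia.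
nia.
Qed.

(* The factorizations of a - 1, b - 1, c - 1 glue to a = 1 + vw, b = 1 + uw,
   c = 1 + uv, and then uvw divides u + v + w, which only leaves
   {a, b, c} = {4, 7, 3}, excluded since 7 * 3 - 1 is not a power of 2. *)
Lemma shift_closed3_pos a b c : ~~ odd a -> ~ shift_closed true [:: a; b; c].
Proof.
move=> ae sC; have [us _ _] := sC.
have [aP ab bcn [u [v [cE un vn ub va]]]] := shift_closed_facts sC.
have [bP bc can [v' [w' [aE vn' wn' vc' wb']]]] :=
  shift_closed_facts (shift_closed_rot sC).
have [cP ca abn [w [u' [bE wn un' wa uc']]]] :=
  shift_closed_facts (shift_closed_rot (shift_closed_rot sC)).
have [pa pb pc] :=
  And3 (pdiv_prime_power aP) (pdiv_prime_power bP) (pdiv_prime_power cP).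
have [a1 b1 c1] :=
  And3 (prime_power_gt1 aP) (prime_power_gt1 bP) (prime_power_gt1 cP).
have pa2 := prime_power_even aP ae.
rewrite /shift in cE aE bE bcn can abn.
have cop (p q : nat) := @pnat_neq_coprime p q.
have uE : u = u'.
  apply: (@dvdn_coprime_eq _ v _ w).
  - by apply: cop un wn; rewrite // eq_sym.
  - exact: cop un' vn.
  - by rewrite mulnC -bE.
  - by rewrite -cE.
have vE : v = v'.
  apply: (@dvdn_coprime_eq _ u _ w').
  - exact: cop vn wn'.
  - by apply: cop vn' un; rewrite // eq_sym.
  - by rewrite -aE.
  - by rewrite mulnC -cE.
have wE : w = w'.
  apply: (@dvdn_coprime_eq _ u' _ v').
  - by apply: cop wn vn'; rewrite // eq_sym.
  - exact: cop wn' un'.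
  - by rewrite mulnC -aE.
  - by rewrite -bE.
subst u' v' w'.
have {}aE : a = (v * w).+1 by rewrite -aE prednK // ltnW.
have {}bE : b = (u * w).+1 by rewrite mulnC -bE prednK // ltnW.
have {}cE : c = (u * v).+1 by rewrite -cE prednK // ltnW.
have [u0 v0 w0] : [/\ 0 < u, 0 < v & 0 < w] by case/andP: un; case/andP: vn; case/andP: wn.
have uS : u %| v + w.
  apply: (pnat_pair_dvd pa) => //; apply: etrans bcn; congr (_.-nat _).
  by rewrite bE cE; clear; nia.
have vS : v %| u + w.
  apply: (pnat_pair_dvd pb) => //; apply: etrans can; congr (_.-nat _).
  by rewrite aE cE; clear; nia.
have wS : w %| u + v.
  apply: (pnat_pair_dvd pc) => //; apply: etrans abn; congr (_.-nat _).
  by rewrite aE bE; clear; nia.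
have S_dvd : u * v * w %| u + v + w.
  rewrite !Gauss_dvd.
  - rewrite (dvdn_addl _ (dvdnn w)) wS andbT addnAC.
    by rewrite (dvdn_addl _ (dvdnn v)) vS addnAC -addnA dvdn_addr // uS.
  - exact: cop un vn.
  - rewrite coprimeMl; apply/andP; split; last exact: cop vn wn.
    by apply: cop un wn; rewrite // eq_sym.
have S_le := dvdn_leq (ltn_addr _ (ltn_addr _ u0)) S_dvd.
have [vo wo] : odd v /\ odd w by move: ae; rewrite aE /= oddM negbK => /andP[].
have bo : odd b.
  by apply/negPn/negP => /(prime_power_even bP) b2; rewrite pa2 b2 in ab.
have ue : ~~ odd u by move: bo; rewrite bE /= oddM wo andbT.
have vw : v != w.
  by apply/eqP => vw; move: us; rewrite bE cE vw /= !inE eqxx !andbF.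
have [u2 vw3 vw4] : [/\ u = 2, v * w = 3 & v + w = 4].
  have u2 : 1 < u by case: (u) u0 ue => [|[]].
  have [lt_vw|lt_wv|//] := ltngtP v w; last by move/eqP: vw.
    by have [] := prod_le_sum u2 vo wo lt_vw S_le; split=> //; subst.
  rewrite [v * w]mulnC [v + w]addnC.
  have S_le' : u * w * v <= u + w + v by rewrite mulnAC addnAC.
  by have [] := prod_le_sum u2 wo vo lt_wv S_le'; split=> //; subst.
move: bcn.
have -> : (b * c).-1 = 20.
  by rewrite bE cE u2; move: vw3 vw4; clear; nia.
by rewrite pa2.
Qed.

Lemma pnat_lt_double (p a u : nat) : prime p -> p.-nat a -> p.-nat u ->
  a < u -> 2 * a <= u.
Proof.
move=> pp an un au.
have /dvdnP[k uE] := pnat_dvd_leq pp an un (ltnW au).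
move: au; rewrite uE leq_mul2r; case: k {uE} => [|[|k]]; rewrite ?mul1n ?ltnn //.
by rewrite orbT.
Qed.

(** The odd prime [q] cannot divide both [c - 1] and [c + 1], and it divides [c - 1] through
    [v']. *)
Lemma pnat_succ_pred (q c v v' : nat) : prime q -> q != 2 -> 0 < c ->
  q.-nat v -> q.-nat v' -> v %| c.+1 -> v' %| c.-1 -> v' != 1 -> v = 1.
Proof.
move=> pq q2 c0 vn vn' vc vc' v1'; apply: (pnat_eq1 pq) => //.
apply/negP => qv; have qc := dvdn_trans qv vc.
have qv' : q %| v' by apply/negPn/negP => /(pnat_eq1 pq vn')/eqP/(negP v1').
have qc' := dvdn_trans qv' vc'.
have : q %| c.+1 - c.-1 by rewrite dvdn_sub.
have -> : c.+1 - c.-1 = 2 by move: c0; clear; lia.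
by rewrite dvdn_prime2 //; apply/negP.
Qed.

(* Either v' and w' are both nontrivial, so that u = c + 1 and u' = b + 1
   bound each other, or c < b <= 2a - 3 while 2a <= c + 1 by comparing powers
   of 2. *)
Lemma shift_neg_arith (q r a b c u v w u' v' w' : nat) :
  prime q -> prime r -> q != 2 -> r != 2 -> 1 < a -> 1 < b -> 1 < c ->
  2.-nat a -> 2.-nat u -> 2.-nat u' -> q.-nat v -> q.-nat v' ->
  r.-nat w -> r.-nat w' ->
  c.+1 = u * v -> u %| b.-1 ->
  a.+1 = v' * w' -> v' %| c.-1 -> w' %| b.-1 ->
  b.+1 = u' * w -> w %| a.-1 -> u' %| c.-1 ->
  v' != 1 -> False.
Proof.
move=> pq pr q2 r2 a1 b1 c1 an un un' vn vn' wn wn' cE ub aE vc' wb' bE wa uc'.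
move=> v1'.
have pred0 n : 1 < n -> 0 < n.-1 by clear; lia.
have v1 : v = 1.
  apply: (pnat_succ_pred pq q2 (ltnW c1) vn vn' _ vc' v1').
  by rewrite cE dvdn_mull.
have {}cE : u = c.+1 by rewrite cE v1 muln1.
have ubl := dvdn_leq (pred0 _ b1) ub.
have ucl' := dvdn_leq (pred0 _ c1) uc'.
have wl := dvdn_leq (pred0 _ a1) wa.
have vl' := dvdn_leq (pred0 _ c1) vc'.
have [w1'|w1'] := eqVneq w' 1; last first.
  have w1 : w = 1.
    apply: (pnat_succ_pred pr r2 (ltnW b1) wn wn' _ wb' w1').
    by rewrite bE dvdn_mull.
  by move: bE ubl ucl'; rewrite w1 cE muln1; clear; lia.
have {}aE : v' = a.+1 by rewrite aE w1' muln1.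
have au : 2 * a <= u.
  by apply: (pnat_lt_double _ an un) => //; move: vl'; rewrite aE cE; clear; lia.
(* Otherwise 4 divides both [u' %| c - 1] and [u = c + 1], which differ by 2 at the level of [c]. *)
have u2' : u' <= 2.
  rewrite leqNgt; apply/negP => u2'.
  have four n : 2.-nat n -> 2 < n -> 4 %| n.
    move=> nn n2; apply: (@pnat_dvd_leq 2) => //.
    exact: (@pnat_lt_double 2 2 n).
  have d1 := dvdn_trans (four u' un' u2') uc'.
  have d2 : 4 %| u by apply: four => //; rewrite cE.
  have : 4 %| u - c.-1 by rewrite dvdn_sub.
  by have -> : u - c.-1 = 2 by rewrite cE; move: c1; clear; lia.
have := leq_mul u2' wl; rewrite -bE.
by move: cE au ubl a1 b1; clear; lia.
Qed.

Lemma shift_closed3_neg a b c : ~~ odd a -> ~ shift_closed false [:: a; b; c].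
Proof.
move=> ae sC.
have [aP ab _ [u [v [cE un vn ub va]]]] := shift_closed_facts sC.
have [bP bc _ [v' [w' [aE vn' wn' vc' wb']]]] :=
  shift_closed_facts (shift_closed_rot sC).
have [cP ca _ [w [u' [bE wn un' wa uc']]]] :=
  shift_closed_facts (shift_closed_rot (shift_closed_rot sC)).
have [pb pc] := (pdiv_prime_power bP, pdiv_prime_power cP).
have [a1 b1 c1] :=
  And3 (prime_power_gt1 aP) (prime_power_gt1 bP) (prime_power_gt1 cP).
have pa2 := prime_power_even aP ae.
have an := prime_power_pnat aP.
rewrite /= in cE aE bE.
rewrite pa2 in an ab ca un un'.
have [v1'|v1'] := eqVneq v' 1; last first.
  by apply: (shift_neg_arith pb pc _ _ a1 b1 c1 an un un' vn vn' wn wn' cE ub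
    aE vc' wb' _ wa uc' v1') => //; rewrite 1?eq_sym 1?mulnC.
(* When [v' = 1], the factor [w' = a + 1] is nontrivial, and the argument applies with [b] and [c]
   exchanged. *)
apply: (shift_neg_arith pc pb _ _ a1 c1 b1 an un' un wn wn' vn vn' _ uc' _ wb'
    vc' cE va ub _); rewrite // 1?eq_sym // 1?mulnC //.
by apply/eqP => w1'; move: a1; rewrite -ltnS aE v1' -w1'.
Qed.

Lemma shift_closed_size e s : shift_closed e s -> size s < 3.
Proof.
move=> sC; rewrite ltnNge; apply/negP => s3.
have [|s4] := leqP (size s) 3; last exact: shift_closed_ge4 s4 sC.
case: s sC s3 => [|a [|b [|c [|]]]] // sC _ _.
have [a' [b' [c' [sC' ae]]]] := shift_closed_even sC.
by case: e sC' {sC} => [/(shift_closed3_pos ae)|/(shift_closed3_neg ae)].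
Qed.

(** * Residues modulo [p] of finite subproducts *)

Section ResiduesOfSubproducts.

Variables (p : nat) (A : set nat).
Hypothesis p_prime : prime p.

Local Open Scope ring_scope.

Definition persistent (r : 'F_p) : Prop :=
  forall E : seq nat, exists t : seq nat,
    [/\ uniq t, t != [::], {in t, forall x, A x /\ x \notin E} &
        (\prod_(x <- t) x)%N%:R = r].

(** The second list is chosen to avoid the first, so their concatenation has no repetition. *)
Lemma persistentM r1 r2 : persistent r1 -> persistent r2 ->
  persistent (r1 * r2).
Proof.
move=> P1 P2 E; have [t1 [u1 n1 A1 <-]] := P1 E.
have [t2 [u2 n2 A2 <-]] := P2 (E ++ t1).
exists (t1 ++ t2); split.
- rewrite cat_uniq u1 u2 andbT; apply/hasPn => x /A2[_].
  by rewrite mem_cat negb_or => /andP[].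
- by case: (t1) n1.
- move=> x; rewrite mem_cat => /orP[/A1 //|/A2[Ax]].
  by rewrite mem_cat negb_or => /andP[].
- by rewrite big_cat natrM.
Qed.

Lemma persistentX r n : persistent r -> persistent (r ^+ n.+1).
Proof.
by move=> Pr; elim: n => // n IHn; rewrite exprS; apply: persistentM.
Qed.

(** Each non-persistent residue has a finite obstruction [E], which must contain every element of
    [A] with that residue, as singletons show. There are finitely many residues, so the union of the
    obstructions works. *)
Lemma persistent_cofinite :
  exists E : seq nat, forall a, A a -> a \notin E -> persistent a%:R.
Proof.
have /choice[E EP] : forall r : 'F_p, exists E : seq nat,
    forall a, A a -> a \notin E -> a%:R = r -> persistent r.
  move=> r; have [Pr|] := pselect (persistent r); first by exists [::].
  move=> /existsNP[E nE]; exists E => a Aa aE ar; case: nE.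
  exists [:: a]; split=> //; last by rewrite big_seq1.
  by move=> x; rewrite inE => /eqP ->.
exists (flatten [seq E r | r <- enum 'F_p]) => a Aa aE.
apply: (EP a%:R a) => //; apply: contra aE => aE.
by apply/flatten_mapP; exists a%:R; rewrite ?mem_enum.
Qed.

Hypothesis A_inf : forall s : seq nat, exists2 a, A a & a \notin s.
Hypothesis A_ndvd : forall a, A a -> ~~ (p %| a)%N.

Lemma natr_Fp_eq0 n : (n%:R == 0 :> 'F_p) = (p %| n)%N.
Proof. by rewrite -(dvdn_pcharf (pchar_Fp p_prime)). Qed.

Lemma persistent_neq0 r : persistent r -> r != 0.
Proof.
move=> /(_ [::])[t [_ _ tA <-]]; rewrite natr_Fp_eq0.
by apply: prime_ndvd_prod => // x /tA[/A_ndvd].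
Qed.

Lemma persistent1 : persistent 1.
Proof.
have [E EP] := persistent_cofinite; have [a Aa aE] := A_inf E.
have Pa := EP a Aa aE.
(* The exponent is [p - 1], written as a successor to fit [persistentX]. *)
have <- : a%:R ^+ p.-2.+1 = 1 :> 'F_p; last exact: persistentX.
have a0 := persistent_neq0 Pa.
apply: (mulfI a0); rewrite mulr1 -exprS -[RHS]expf_card card_Fp //.
by congr (_ ^+ _); have := prime_gt1 p_prime; lia.
Qed.

Lemma persistent_natr n : (0 < n)%N ->
  (forall q, prime q -> (q %| n)%N -> persistent q%:R) -> persistent n%:R.
Proof.
move=> n0 nP; rewrite (prod_prime_decomp n0) natr_prod big_seq.
elim/big_ind: _ => [|x y|[q k]]; [exact: persistent1|exact: persistentM|].
move=> /mem_prime_decomp[pq k0 qn] /=; rewrite natrX -(prednK k0).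
apply: persistentX; apply: nP pq _; apply: dvdn_trans qn.
by rewrite -(prednK k0) expnS dvdn_mulr.
Qed.

Lemma persistent_no_affine (f : 'F_p) : f != 0 ->
  ~ (forall h, persistent h -> persistent (f * h + 1)).
Proof.
move=> f0 fP.
pose H := [set h : 'F_p | `[< persistent h >]]%SET.
pose g h := f * h + 1.
have ginj : injective g by move=> x y /addIr /(mulfI f0).
have gH : g @: H = H.
  apply/eqP; rewrite eqEcard (card_imset _ ginj) leqnn andbT.
  apply/fintype.subsetP => y /imsetP[x]; rewrite inE => /asboolP Px ->.
  by rewrite inE; apply/asboolP/fP.
have : 1 \in g @: H by rewrite gH inE; apply/asboolP/persistent1.
move=> /imsetP[h]; rewrite inE => /asboolP Ph /eqP.
rewrite -subr_eq0 /g opprD addrCA subrr addr0 oppr_eq0 mulf_eq0.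
by rewrite (negbTE f0) (negbTE (persistent_neq0 Ph)).
Qed.

End ResiduesOfSubproducts.

(** * Passage to sets and conclusion *)

Lemma dvdz_shift e (eps0 : int) q n : 0 < n ->
  eps0 = (if e then 1 else - 1)%R ->
  (q%:Z %| (n%:Z - eps0)%R)%Z = (q %| shift e n).
Proof.
move=> n0 ->; case: e => /=.
  by have -> : (n%:Z - 1 = n.-1%:Z)%R by lia.
by have -> : (n%:Z - - 1 = n.+1%:Z)%R by lia.
Qed.

(** Since [A] may be infinite, properness of [t] is witnessed by an element outside it. *)
Definition shift_closed_set e (A : set nat) : Prop :=
  forall q t, prime q -> uniq t -> t != [::] -> {in t, forall x, A x} ->
    (exists2 x, A x & x \notin t) -> q %| shift e (\prod_(x <- t) x) ->
    exists2 a, A a & q %| a.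

Lemma shift_closed_setP e (eps0 : int) (A : set nat) :
  eps0 = (if e then 1 else - 1)%R ->
  (forall a, A a -> prime_power a) ->
  (forall (q : nat) (B : {fset nat}), prime q -> Pstar A B ->
     (q%:Z %| ((\prod_(a <- B) a)%N%:Z - eps0)%R)%Z ->
     exists2 a, A a & q %| a) ->
  shift_closed_set e A.
Proof.
move=> epsE AP AD q t pq ut t0 tA [x Ax xt] qd.
pose B : {fset nat} := [fset y in t]%fset.
have BE : \prod_(a <- B) a = \prod_(a <- t) a.
  apply: perm_big; apply: uniq_perm; rewrite ?fset_uniq // => y.
  by rewrite !inE.
apply: (AD q B pq); last first.
  rewrite BE (dvdz_shift _ _ epsE) //.
  by apply: prod_gt0 => y /tA /AP.
split.
  case: (t) t0 @B {BE} => // y u _ B; apply/fset0Pn; exists y.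
  by rewrite !inE eqxx.
split=> [y /=|/(_ x Ax) /=]; first by rewrite !inE => /tA.
by rewrite !inE; apply/negP.
Qed.

Lemma shift_closed_set_infinite e (A : set nat) :
  (forall a, A a -> prime_power a) -> (`I_3 #<= A)%card ->
  shift_closed_set e A -> infinite_set A.
Proof.
move=> AP cA AD /finite_fsetP[B AB].
have : shift_closed e B.
  split; rewrite ?fset_uniq //; first by move=> x xB; apply: AP; rewrite AB.
  move=> q t pq ut tB t0 lt_tB qd.
  have [||a] := AD q t pq ut t0 _ _ qd.
  - by move=> x /tB xB; rewrite AB.
  - have /hasP[x xB xt] : has [pred x | x \notin t] B.
      apply/negPn; rewrite -all_predC; apply/negP => /allP Bt.
      move: lt_tB; rewrite ltnNge uniq_leq_size ?fset_uniq // => x /Bt /=.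
      by rewrite negbK.
    by exists x => //; rewrite AB.
  - by rewrite AB => aB qa; exists a.
move=> /shift_closed_size; rewrite ltnNge => /negP; apply.
rewrite -[B]set_fsetK -AB; apply: leq_card_fset_set cA.
by rewrite AB; exact: finite_fset.
Qed.

Lemma infinite_set_notin (A : set nat) (s : seq nat) : infinite_set A ->
  exists2 a, A a & a \notin s.
Proof.
move=> Ainf; apply: contrapT => nA; apply: Ainf.
apply: (@sub_finite_set _ _ [set` s]) => [a Aa /=|]; last exact: finite_seq.
by apply/negPn/negP => a_s; apply: nA; exists a.
Qed.

Lemma shift_closed_set_dvd (A : set nat) p : infinite_set A ->
  shift_closed_set true A -> prime p -> exists2 a, A a & p %| a.
Proof.
move=> Ainf AD pp; apply: contrapT => nA.
have A_ndvd a : A a -> ~~ (p %| a).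
  by move=> Aa; apply/negP => pa; case: nA; exists a.
have A_inf s := infinite_set_notin s Ainf.
have [t [ut t0 tA tE]] := persistent1 pp A_inf A_ndvd [::].
apply: nA; apply: (AD p t) => //.
- by move=> x /tA[].
(* Positivity makes the truncated predecessor a true difference, whose residue is 1 - 1. *)
- have t1 : 0 < \prod_(x <- t) x.
    rewrite lt0n; apply/eqP => t1; move/eqP: tE; rewrite t1 eq_sym.
    by rewrite oner_eq0.
  rewrite -(natr_Fp_eq0 pp) /= -subn1 natrB // tE.
  by rewrite subrr.
Qed.

(* If p were missing from A, then, with F a finite set containing all elements
   of A with non-persistent residue and f its product, every prime factor of
   f h + 1 has persistent residue, so x |-> f x + 1 would permute the persistent
   residues although it does not take the value 1 on units. *)
Lemma shift_closed_set_primes (A : set nat) p : infinite_set A ->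
  A `<=` primeset -> shift_closed_set false A -> prime p -> A p.
Proof.
move=> Ainf AP AD pp; apply: contrapT => nAp.
have A_ndvd a : A a -> ~~ (p %| a).
  move=> Aa; rewrite dvdn_prime2 //; last exact: AP.
  by apply/eqP => pa; apply: nAp; rewrite pa.
have A_inf s := infinite_set_notin s Ainf.
have [E EP] := persistent_cofinite p A.
have [a0 Aa0 _] := A_inf [::].
pose F := undup (a0 :: [seq x <- E | `[< A x >]]).
have FA x : x \in F -> A x.
  by rewrite mem_undup inE mem_filter => /orP[/eqP ->|/andP[/asboolP]].
have FE x : A x -> x \notin F -> x \notin E.
  move=> Ax; apply: contra => xE; rewrite mem_undup inE mem_filter xE andbT.
  by apply/orP; right; apply/asboolP.
have f0 : ((\prod_(x <- F) x)%:R != 0 :> 'F_p)%R.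
  by rewrite (natr_Fp_eq0 pp) prime_ndvd_prod // => x /FA /A_ndvd.
apply: (persistent_no_affine pp A_inf A_ndvd f0) => h /(_ F)[t [ut t0 tA <-]].
rewrite -natrM -big_cat /= natr1.
have sA : {in F ++ t, forall x, A x}.
  by move=> x; rewrite mem_cat => /orP[/FA|/tA[]].
apply: (persistent_natr pp A_inf A_ndvd) => // q pq qd.
have [|||a Aa qa] := AD q (F ++ t) pq _ _ sA _ qd.
- rewrite cat_uniq undup_uniq ut andbT; by apply/hasPn => x /tA[].
- by rewrite -size_eq0 size_cat addn_eq0 negb_and !size_eq0 t0 orbT.
- exact: A_inf.
have {qa} qa : q = a by apply/eqP; rewrite -dvdn_prime2 //; exact: AP.
(* If [q] were in [F], it would divide both the product and the product plus 1. So [q] lies outside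
   [E] and its residue is persistent. *)
rewrite -{a}qa in Aa; apply: EP => //; apply: FE => //; apply/negP => qF.
have qs : q %| \prod_(x <- F ++ t) x by rewrite dvdn_prod_mem // mem_cat qF.
by move: qd; rewrite -addn1 dvdn_addr // dvdn1 => /eqP q1; rewrite q1 in pq.
Qed.

Theorem theorem3 (eps0 : int) (A : set nat)
  (heps0 : eps0 = 1%R \/ eps0 = (-1)%R)
  (hpow : forall a, A a -> prime_power a)
  (hcard : (`I_3 #<= A)%card)
  (hdiv : forall (q : nat) (B : {fset nat}),
     prime q -> Pstar A B ->
     (q%:Z %| ((\prod_(a <- B) a)%N%:Z - eps0)%R)%Z ->
     exists2 a, A a & q %| a) :
  [/\ infinite_set A,
      eps0 = 1%R -> forall p : nat, prime p -> exists2 a, A a & p %| a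
    & A `<=` primeset -> A = primeset].
Proof.
have [e epsE] : exists e : bool, eps0 = (if e then 1 else - 1)%R.
  by case: heps0 => ->; [exists true | exists false].
have AD := shift_closed_setP epsE hpow hdiv.
have Ainf := shift_closed_set_infinite hpow hcard AD.
split=> // [eps1|AP].
  case: e epsE AD => epsE AD; first by move=> p; exact: shift_closed_set_dvd.
  by rewrite eps1 in epsE.
rewrite eqEsubset; split=> // p pp; case: e {epsE} AD => AD.
  have [a Aa] := shift_closed_set_dvd Ainf AD pp.
  by rewrite dvdn_prime2 // => [/eqP ->|]; last exact: AP.
exact: shift_closed_set_primes.
Qed.
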